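(* Let $d\ge1$, $\sigma>0$, and let $(P_t)_{t\ge0}$ be the heat semigroup generated by $(Lf)(p,\xi)=\sum_{j=1}^d p_j\,\partial_{\xi_j}f(p,\xi)+\frac{\sigma^2}{2}\Delta_p f(p,\xi)$ on $\mathbb{R}^d\times\mathbb{R}^d$. Let $f$ be a non-negative bounded Borel function on $\mathbb{R}^d\times\mathbb{R}^d$. Then for every $t>0$, all $(p,\xi),(p',\xi')\in\mathbb{R}^d\times\mathbb{R}^d$ and every $\alpha>1$, \[(P_tf)^\alpha(p,\xi)\le C_\alpha\big(t,(p,\xi),(p',\xi')\big)\,(P_tf^\alpha)(p',\xi'),\] where \[C_\alpha\big(t,(p,\xi),(p',\xi')\big)=\exp\left(\frac{\alpha}{\alpha-1}\left(\frac{6}{\sigma^2t^3}\sum_{i=1}^d\Big(\frac t2(p_i'-p_i)+(\xi_i'-\xi_i)\Big)^2+\frac{1}{2\sigma^2t}\sum_{i=1}^d(p_i'-p_i)^2\right)\right).\]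
   Context: $P_tf(p,\xi)=\mathbb{E}\,f\big(p+B_t,\xi+tp+\int_0^tB_sds\big)$, where $B$ is a Brownian motion in $\mathbb{R}^d$ with variance $\sigma^2$ started at $0$. *)

(* Defs.v *)
From HB Require Import structures.
From mathcomp Require Import all_boot all_order all_algebra.
From mathcomp Require Import all_classical all_reals all_analysis.
Set Implicit Arguments. Unset Strict Implicit. Unset Printing Implicit Defensive.
Import Order.TTheory GRing.Theory Num.Theory.
Import numFieldNormedType.Exports.
Local Open Scope classical_set_scope.
Local Open Scope ring_scope.

(* A d-dimensional Brownian motion with variance sigma^2 (covariance sigma^2 I),
   started at 0, on the probability space (T, P).  Coordinate i at time s and
   outcome w is  B i s w.  The defining properties:
   - B_0 = 0;
   - every path s |-> B i s w is continuous on [0, +oo);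
   - every B i s is a (Borel) random variable;
   - for all times 0 <= t_0 < t_1 < ... < t_n, the increments
     B^i_{t_{k+1}} - B^i_{t_k} (k < n, i < d) are mutually independent and
     N(0, sigma^2 (t_{k+1} - t_k))-distributed, i.e. the joint law is the
     product law on all boxes:                                               *)
Definition is_brownian_motion {R : realType} {dT : measure_display}
  {T : measurableType dT} (P : probability T R) (d : nat) (sigma : R)
  (B : 'I_d -> R -> T -> R) : Prop :=
  [/\ (forall i w, B i 0 w = 0),
      (forall i w, {within `[0, +oo[, continuous (fun s => B i s w)}),
      (forall i s, measurable_fun setT (B i s)) &
      (forall (n : nat) (ts : nat -> R) (A : nat -> 'I_d -> set R),
          0 <= ts 0%N ->
          (forall k, (k < n)%N -> ts k < ts k.+1) ->
          (forall k i, measurable (A k i)) ->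
          P (\big[setI/setT]_(k < n) \big[setI/setT]_(i < d)
               [set w | B i (ts k.+1) w - B i (ts k) w \in A k i])
          = (\prod_(k < n) \prod_(i < d)
               normal_prob 0 (sigma * Num.sqrt (ts k.+1 - ts k)) (A k i))%E)].

Definition kolmogorov_semigroup {R : realType} {dT : measure_display}
  {T : measurableType dT} (P : probability T R) (d : nat)
  (B : 'I_d -> R -> T -> R) (t : R)
  (f : d.-tuple R * d.-tuple R -> R) (x : d.-tuple R * d.-tuple R) : \bar R :=
  (\int[P]_w
     (f ([tuple tnth x.1 i + B i t w | i < d],
         [tuple tnth x.2 i + t * tnth x.1 i
                + Rintegral lebesgue_measure `[0, t] (fun s => B i s w)
            | i < d]))%:E)%E.

Definition C_alpha {R : realType} (d : nat) (sigma alpha t : R)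
  (x y : d.-tuple R * d.-tuple R) : R :=
  expR (alpha / (alpha - 1) *
    (6 / (sigma ^+ 2 * t ^+ 3) *
       \sum_(i < d) (t / 2 * (tnth y.1 i - tnth x.1 i)
                     + (tnth y.2 i - tnth x.2 i)) ^+ 2
     + 1 / (2 * sigma ^+ 2 * t) *
       \sum_(i < d) (tnth y.1 i - tnth x.1 i) ^+ 2)).

(* Main.v *)
(** Tilting the Gaussian increments of the Brownian motion by deterministic
    shifts turns the law of the process started at [y] into that started at
    [x]; Hoelder's inequality applied to the density gives a
    Harnack inequality in one variable, and this inequality tensorises.  On a
    grid of [N] steps the integral of [B] is replaced by its trapezoidal sum,
    a linear function of the increments; the cheapest shifts steering [y] to
    [x] are affine in the time index and their cost tends to the exponent of [C_alpha] as
    [N] grows.  Dominated convergence then yields the inequality for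
    sequentially continuous functions, and approximation in [L^1] of the sum
    of the two laws extends it to bounded Borel functions. *)
Require Import Defs.
From HB Require Import structures.
From mathcomp Require Import all_boot all_order all_algebra.
From mathcomp Require Import all_classical all_reals all_analysis.
From mathcomp Require Import measurable_realfun ring lra.
Set Implicit Arguments. Unset Strict Implicit. Unset Printing Implicit Defensive.
Import Order.TTheory GRing.Theory Num.Theory.
Import numFieldNormedType.Exports.
Local Open Scope classical_set_scope.
Local Open Scope ring_scope.

(** * The one-dimensional Gaussian Harnack inequality *)

Section density.
Local Open Scope ereal_scope.
Import HBNNSimple.

(** A Brownian motion is available here only through the joint laws of finitely many increments, so
    the tilting is done on a grid rather than in path space. The grid states converge only along
    paths, which carries integrals of continuous test functions to the limit but not those of Borel
    ones; hence the separate approximation. The constants come from a least-squares problem. Let g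
    on [0, t] have integral p, and let (t - s) g(s) have integral c. The cheapest g is affine, and
    its square integrates to p^2 / t + 12 (c - t p / 2)^2 / t^3. With p = x.1 - y.1 and c = x.2 -
    y.2 + t p in each coordinate, division by 2 sigma^2 gives the two sums in [C_alpha]. The factor
    alpha / (alpha - 1) is the conjugate exponent from Hoelder. Exponents add up under
    tensorisation, so nothing is lost on the way. *)

Lemma ge0_integral_density d (T : measurableType d) (R : realType)
  (mu nu : {measure set T -> \bar R}) (g : T -> R) (f : T -> \bar R) :
  measurable_fun setT g -> (forall x, (0 <= g x)%R) ->
  (forall A, measurable A -> nu A = \int[mu]_(x in A) (g x)%:E) ->
  measurable_fun setT f -> (forall x, 0 <= f x) ->
  \int[nu]_x f x = \int[mu]_x (f x * (g x)%:E).
Proof.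
move=> mg g0 nuE mf f0.
pose f_ := nnsfun_approx measurableT mf.
have fcvg x : (f_ n x)%:E @[n --> \oo] --> f x.
  by apply: cvg_nnsfun_approx.
have ndf x : {homo (fun n => (f_ n x)%:E) : m n / (m <= n)%N >-> m <= n}.
  by move=> m n mn; rewrite lee_fin; exact/lefP/nd_nnsfun_approx.
have mgE : measurable_fun setT (EFin \o g) by exact/measurable_EFinP.
have limE x : limn (fun n => (f_ n x)%:E) = f x by exact: cvg_lim.
have lim2 x : limn (fun n => (f_ n x)%:E * (g x)%:E) = f x * (g x)%:E.
  by apply: cvg_lim => //; apply: cvgeZr => //; exact: fcvg.
rewrite -(eq_integral _ _ (fun x _ => limE x))//.
rewrite -(eq_integral _ _ (fun x _ => lim2 x))//.
rewrite [LHS]monotone_convergence//; last 2 first.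
- by move=> n; exact/measurable_EFinP.
- by move=> n x _; rewrite lee_fin.
rewrite [RHS]monotone_convergence//; last 3 first.
- by move=> n; apply: emeasurable_funM => //; exact/measurable_EFinP.
- by move=> n x _; rewrite mule_ge0 ?lee_fin//.
- by move=> x _ m n mn; rewrite lee_wpmul2r// ?lee_fin// -lee_fin; exact: ndf.
- congr (limn _); apply/funext => n.
  have fE x : (f_ n x)%:E = \sum_(r \in range (f_ n)) (r * \1_(f_ n @^-1` [set r]) x)%:E.
    by rewrite fimfunE fsumEFin.
  have fgE x : (f_ n x)%:E * (g x)%:E = \sum_(r \in range (f_ n))
      ((r * \1_(f_ n @^-1` [set r]) x)%:E * (g x)%:E).
    rewrite fE ge0_mule_fsuml// => r.
    by rewrite EFinM; exact: nnfun_muleindic_ge0.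
  under eq_integral do rewrite fE.
  under [RHS]eq_integral do rewrite fgE.
  rewrite [LHS]ge0_integral_fsum//; last 2 first.
  + by move=> r; apply/measurable_EFinP; exact: measurable_funM.
  + by move=> r x _; rewrite EFinM; exact: nnfun_muleindic_ge0.
  rewrite [RHS]ge0_integral_fsum//; last 2 first.
  + move=> r; apply: emeasurable_funM => //; apply/measurable_EFinP.
    exact: measurable_funM.
  + move=> r x _; rewrite mule_ge0 ?lee_fin//.
    by rewrite -lee_fin EFinM; exact: nnfun_muleindic_ge0.
  apply: eq_fsbigr => r /[!inE] [[z _ <-]].
  have mA : measurable (f_ n @^-1` [set f_ n z]) by [].
  set A := _ @^-1` _ in mA *.
  have mAE : measurable_fun setT (fun x : T => (\1_A x)%:E : \bar R).
    exact/measurable_EFinP.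
  under eq_integral do rewrite EFinM.
  under [RHS]eq_integral do rewrite EFinM -muleA.
  rewrite [LHS]ge0_integralZl_EFin//.
  rewrite [RHS]ge0_integralZl_EFin//; last 2 first.
  + by move=> x _; rewrite mule_ge0// lee_fin.
  + exact: emeasurable_funM.
  rewrite integral_indic// setIT nuE// integral_mkcond; congr (_ * _).
  apply: eq_integral => x _; rewrite patchE/= indicE.
  by case: ifPn => _; rewrite ?mul1e ?mul0e.
Qed.
End density.

Section gaussian.
Local Open Scope ereal_scope.
Variable R : realType.
Notation mu := (@lebesgue_measure R).

(** Lebesgue measure is determined by its values on half-open intervals, and a translation preserves
    their lengths. *)
Lemma ge0_integral_lebesgueD (h : R) (f : R -> \bar R) :
  measurable_fun setT f -> (forall x, 0 <= f x) ->
  \int[mu]_x f (x + h)%R = \int[mu]_x f x.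
Proof.
move=> mf f0.
pose sh : measurableTypeR R -> measurableTypeR R := fun x => (x + h)%R.
have msh : measurable_fun setT sh by exact: measurable_funD.
pose S : {mfun measurableTypeR R >-> measurableTypeR R} :=
  HB.pack sh (isMeasurableFun.Build _ _ _ _ _ msh).
transitivity (\int[pushforward mu S]_x f x).
  by rewrite ge0_integral_pushforward.
apply: eq_measure_integral => A mA _; apply/esym/lebesgue_measure_unique => //.
move=> _ [[a b]] _ <-; rewrite /= /pushforward.
have -> : sh @^-1` `]a, b]%classic = `](a - h)%R, (b - h)%R]%classic.
  by apply/funext => x; rewrite /preimage/= !in_itv/= ltrBlDr lerBrDr.
rewrite !lebesgue_measure_itv/= !lte_fin ltrD2r.
by case: ifPn => // _; rewrite -!EFinB opprB addrA subrK.
Qed.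

Lemma ge0_integral_normal_prob (m s : R) (f : R -> \bar R) :
  measurable_fun setT f -> (forall x, 0 <= f x) ->
  \int[normal_prob m s]_x f x = \int[mu]_x (f x * (normal_pdf m s x)%:E).
Proof.
move=> mf f0; apply: ge0_integral_density => //.
- exact: measurable_normal_pdf.
- by move=> x; exact: normal_pdf_ge0.
Qed.

End gaussian.
Arguments ge0_integral_lebesgueD {R} h f.
Arguments ge0_integral_normal_prob {R} m s f.

Section gaussian_harnack.
Local Open Scope ereal_scope.
Variable R : realType.

(** With the peak moved into the exponent, products and powers of densities reduce to identities
    between exponents. *)
Lemma normal_pdf_expR (s x : R) : (s != 0)%R ->
  normal_pdf 0 s x = expR (ln (normal_peak s) - x ^+ 2 / (s ^+ 2 *+ 2))%R.
Proof.
move=> s0; rewrite normal_pdfE// expRD lnK ?posrE ?normal_peak_gt0//.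
by rewrite /normal_fun subr0 mulNr.
Qed.

Lemma normal_prob_harnack (s h a : R) (f : R -> R) :
  (s != 0)%R -> (1 < a)%R -> measurable_fun setT f -> (forall x, 0 <= f x)%R ->
  (\int[normal_prob 0 s]_x (f (x + h)%R)%:E) `^ a <=
  (expR (a / (a - 1) * (h ^+ 2 / (s ^+ 2 *+ 2))))%:E *
  \int[normal_prob 0 s]_x (f x `^ a)%:E.
Proof.
move=> s0 a1 mf f0.
pose q := (a / (a - 1))%R.
have a0 : (0 < a)%R by rewrite (lt_trans _ a1).
have am10 : (0 < a - 1)%R by rewrite subr_gt0.
have q0 : (0 < q)%R by rewrite divr_gt0.
have aq : (a^-1 + q^-1 = 1)%R.
  by rewrite /q; field; rewrite !gt_eqF.
(* Hoelder with f(x) g(x - h) = (f g^(1/a)) (g(x - h) g^(-1/a)), g the density: the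
   q-th power of the second factor is exp(q(q-1)h^2/(2s^2)) g(x - qh). *)
pose L x := (ln (normal_peak s) - x ^+ 2 / (s ^+ 2 *+ 2))%R.
have mL : measurable_fun setT L.
  apply: measurable_funB => //; apply: measurable_funM => //.
pose u x := (f x * expR (L x / a))%R.
pose v x := expR (L (x - h) - L x / a)%R.
have mu_ : measurable_fun setT u.
  apply: measurable_funM => //; apply: measurableT_comp => //.
  exact: measurable_funM.
have mv : measurable_fun setT v.
  apply: measurableT_comp => //; apply: measurable_funB; last exact: measurable_funM.
  apply: (measurableT_comp mL); exact: measurable_funB.
have mf' : measurable_fun setT (fun x => (f x)%:E) by exact/measurable_EFinP.
have mfa : measurable_fun setT (fun x => (f x `^ a)%:E).
  apply/measurable_EFinP.
  exact: (measurableT_comp (measurable_powR a)).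
have := @hoelder _ _ _ (@lebesgue_measure R) u v a q mu_ mv a0 q0 aq.
have uv x : (u x * v x = f x * normal_pdf 0 s (x - h))%R.
  by rewrite /u /v -mulrA -expRD normal_pdf_expR// addrCA subrr addr0.
have -> : 'N[lebesgue_measure]_1[EFin \o (u \* v)%R] =
    \int[normal_prob 0 s]_x (f (x + h)%R)%:E.
  rewrite Lnorm1 ge0_integral_normal_prob//; last 2 first.
  - apply/measurable_EFinP; apply: (measurableT_comp mf).
    exact: measurable_funD.
  - by move=> x; rewrite lee_fin.
  (* Translating the variable by [h] moves the shift from the density to [f]. *)
  rewrite -[LHS](ge0_integral_lebesgueD h)//; last first.
    apply/measurable_EFinP; apply: measurableT_comp => //.
    exact: measurable_funM.
  apply: eq_integral => x _ /=.
  by rewrite uv addrK ger0_norm// mulr_ge0// normal_pdf_ge0.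
move=> /(gt0_ler_poweR (ltW a0)); rewrite !in_itv/= !leey !andbT => H.
apply: le_trans.
  apply: H; first by apply: integral_ge0 => x _; rewrite lee_fin.
  by rewrite mule_ge0// Lnorm_ge0.
rewrite poweRM ?Lnorm_ge0// poweR_Lnorm ?gt_eqF// muleC.
have -> : 'N[lebesgue_measure]_q%:E[EFin \o v] =
    (expR ((q - 1) * (h ^+ 2 / (s ^+ 2 *+ 2))))%:E.
  have vq x : (v x `^ q = expR (q * (q - 1) * (h ^+ 2 / (s ^+ 2 *+ 2))) *
                          normal_pdf 0 s (x - q * h))%R.
    rewrite /v -expRM normal_pdf_expR// -expRD /L /q; congr expR.
    field.
    by rewrite s0 !gt_eqF.
  rewrite unlock.
  under eq_integral => x _.
    rewrite /= ger0_norm ?expR_ge0// vq EFinM. over.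
  rewrite ge0_integralZl_EFin ?expR_ge0//; last 2 first.
  - by move=> x _; rewrite lee_fin normal_pdf_ge0.
  - apply/measurable_EFinP.
    apply: (measurableT_comp (measurable_normal_pdf _ _)).
    exact: measurable_funB.
  have -> : \int[lebesgue_measure]_x (normal_pdf 0 s (x - q * h))%:E = 1.
    rewrite -(@integral_normal_pdf R 0 s).
    rewrite -[LHS](ge0_integral_lebesgueD (q * h)).
    - by under eq_integral do rewrite addrK.
    - apply/measurable_EFinP.
      apply: (measurableT_comp (measurable_normal_pdf _ _)).
      exact: measurable_funB.
    - by move=> x; rewrite lee_fin normal_pdf_ge0.
  rewrite mule1 poweR_EFin -expRM; congr (expR _)%:E.
  field; rewrite s0 gt_eqF//.
(* Only Hoelder loses anything; the rest is an equality, since a (q - 1) = a / (a - 1). *)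
rewrite poweR_EFin -expRM.
rewrite le_eqVlt; apply/orP; left; apply/eqP; congr (_ * _).
  congr (expR _)%:E; rewrite /q; field. by rewrite s0 !gt_eqF.
rewrite [RHS]ge0_integral_normal_prob//; last first.
  by move=> x; rewrite lee_fin powR_ge0.
apply: eq_integral => x _ /=.
rewrite ger0_norm; last by rewrite mulr_ge0// expR_ge0.
rewrite -EFinM; congr EFin.
rewrite normal_pdf_expR// -/(L x) powRM ?expR_ge0// -expRM.
by rewrite divfK// gt_eqF.
Qed.
End gaussian_harnack.

(** * Independent Gaussian families *)

Lemma bigsetI_ord_setT (U : Type) n (A : 'I_n -> set U) :
  \big[setI/setT]_(j < n) A j = [set w | forall j, A j w].
Proof.
rewrite -bigcap_seq; apply/seteqP; split => w /= h j; last by move=> _; exact: h.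
by apply: (h j); rewrite /= mem_index_enum.
Qed.

Section tuple_boxes.
Context d (T : measurableType d) (n : nat).

(** Boxes form a pi-system, as uniqueness of measures requires. The one-coordinate cylinders below
    are used where a generating family is enough. *)
Definition tuple_boxes : set (set (n.-tuple T)) :=
  [set B | exists2 A : 'I_n -> set T, (forall j, measurable (A j)) &
     B = [set v | forall j, A j (tnth v j)]].

Definition tuple_cylinders : set (set (n.-tuple T)) :=
  [set B | exists i, exists2 A, measurable A & B = (fun v => tnth v i) @^-1` A].

Lemma measurable_sub_tuple_cylinders : measurable `<=` <<s tuple_cylinders >>.
Proof.
apply: smallest_sub; first exact: smallest_sigma_algebra.
rewrite (_ : \big[setU/set0]_(i < n) _ = \bigcup_(i in [set: 'I_n])
   preimage_set_system setT (fun x => @tnth n T x i) measurable).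
  move=> B [i _ [A mA <-]]; apply: sub_sigma_algebra.
  by exists i, A => //; rewrite setTI.
rewrite -bigcup_seq; apply/seteqP; split => B [i _ iB]; exists i => //.
by rewrite /= mem_index_enum.
Qed.

Lemma measurable_tuple_boxes : measurable = <<s tuple_boxes >>.
Proof.
rewrite eqEsubset; split.
- apply: subset_trans measurable_sub_tuple_cylinders _.
  apply: smallest_sub; first exact: smallest_sigma_algebra.
  move=> _ [i [A mA ->]]; apply: sub_sigma_algebra.
  exists (fun j => if j == i then A else setT) => [j|]; first by case: ifPn.
  apply/seteqP; split => v /=.
    by move=> Av j; case: ifPn => // /eqP ->.
  by move=> /(_ i); rewrite eqxx.
- apply: smallest_sub; first exact: sigma_algebra_measurable.
  move=> _ [A mA ->].
  rewrite (_ : [set v | _] = \big[setI/setT]_(j < n)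
     ((fun v : n.-tuple T => tnth v j) @^-1` A j)).
    apply: bigsetI_measurable => j _; rewrite -[X in measurable X]setTI.
    exact: measurable_tnth.
  by rewrite bigsetI_ord_setT.
Qed.

Lemma setI_closed_tuple_boxes : setI_closed tuple_boxes.
Proof.
move=> _ _ [A mA ->] [B mB ->]; exists (fun j => A j `&` B j) => [j|].
  exact: measurableI.
apply/seteqP; split => v /=; first by move=> [h1 h2] j; split.
by move=> h; split=> j; have [] := h j.
Qed.

Lemma tuple_boxesT : tuple_boxes setT.
Proof. by exists (fun=> setT) => //; apply/seteqP; split. Qed.

End tuple_boxes.

Lemma mktuple_recl (U : Type) n (F : 'I_n.+1 -> U) :
  [tuple F j | j < n.+1] =
  [tuple of F ord0 :: [tuple F (lift ord0 j) | j < n]].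
Proof.
apply: eq_from_tnth => i; rewrite tnth_mktuple.
case: (unliftP ord0 i) => [j ->|->]; last by rewrite tnth0.
by rewrite tnthS tnth_mktuple.
Qed.

Section gaussian_family.
Local Open Scope ereal_scope.
Context dT (T : measurableType dT) (R : realType) (P : probability T R).

(** Independence and the common law, of standard deviation [s], in one formula; subfamilies are
    recovered by taking some [A j] to be [setT]. *)
Definition gaussian_family (s : R) n (W : 'I_n -> T -> R) :=
  (forall j, measurable_fun setT (W j)) /\
  forall A : 'I_n -> set R, (forall j, measurable (A j)) ->
    P (\big[setI/setT]_(j < n) [set w | A j (W j w)]) =
    \prod_(j < n) normal_prob 0 s (A j).

Lemma gaussian_family_behead s n (W : 'I_n.+1 -> T -> R) :
  gaussian_family s W -> gaussian_family s (fun j => W (lift ord0 j)).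
Proof.
move=> [mW iW]; split=> // A mA.
have := iW (fun j => if unlift ord0 j is Some k then A k else setT).
rewrite !big_ord_recl/= unlift_none setTI.
rewrite probability_setT mul1e.
under eq_bigr do rewrite liftK.
under [in RHS]eq_bigr do rewrite liftK.
by apply=> j; case: (unlift _ _).
Qed.

Lemma measurable_mktuple n (W : 'I_n -> T -> R) :
  (forall j, measurable_fun setT (W j)) ->
  measurable_fun setT (fun w => [tuple W j w | j < n]).
Proof.
move=> mW; apply/measurable_fun_tnthP => i.
by apply: eq_measurable_fun (mW i) => w _ /=; rewrite tnth_mktuple.
Qed.

(** For fixed [A] both sides are finite measures in [B] that agree on boxes by the product
    formula. *)
Lemma gaussian_family_indep s n (W : 'I_n.+1 -> T -> R)
    (A : set R) (B : set (n.-tuple R)) :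
  gaussian_family s W -> measurable A -> measurable B ->
  P [set w | A (W ord0 w) /\ B [tuple W (lift ord0 j) w | j < n]] =
  normal_prob 0 s A * P [set w | B [tuple W (lift ord0 j) w | j < n]].
Proof.
move=> gW mA mB; have [mW iW] := gW.
have [mW' iW'] := gaussian_family_behead gW.
pose X w := [tuple W (lift ord0 j) w | j < n].
have mX : measurable_fun setT X by exact: measurable_mktuple.
pose SX : {mfun T >-> n.-tuple R} := HB.pack X (isMeasurableFun.Build _ _ _ _ _ mX).
have mD : measurable [set w | A (W ord0 w)].
  by rewrite -[X in measurable X]setTI; exact: mW.
(* [mscale] takes a non-negative real factor, hence the detour through [fine]. *)
have nA0 : (0 <= fine (normal_prob 0 s A))%R by rewrite fine_ge0.
pose m1 := pushforward (mrestr P mD) SX.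
pose m2 := mscale (NngNum nA0) (distribution P SX).
have nAE : (fine (normal_prob 0 s A))%:E = normal_prob 0 s A.
  by rewrite fineK// fin_num_measure.
have m1E C : m1 C = P [set w | A (W ord0 w) /\ C (X w)].
  by rewrite /m1/= /pushforward /mrestr setIC.
have m2E C : m2 C = normal_prob 0 s A * P [set w | C (X w)].
  by rewrite /m2/= /mscale/= nAE.
rewrite -m1E -m2E.
apply: (@measure_unique _ R _ (@tuple_boxes _ R n) (fun=> setT)) => //.
- exact: measurable_tuple_boxes.
- exact: setI_closed_tuple_boxes.
- by move=> _; exact: tuple_boxesT.
- exact: bigcup_const.
- move=> _ [C mC ->]; rewrite -[LHS]/(m1 _) -[RHS]/(m2 _) m1E m2E.
  have EX : [set w | forall j, C j (tnth (X w) j)] =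
      \big[setI/setT]_(j < n) [set w | C j (W (lift ord0 j) w)].
    rewrite bigsetI_ord_setT; apply/seteqP; split => w h j; have := h j;
    by rewrite tnth_mktuple.
  rewrite -[X in P X]/([set w | A (W ord0 w)] `&` [set w | forall j, C j (tnth (X w) j)]).
  rewrite -[[set w | [set v | _] _]]/[set w | forall j, C j (tnth (X w) j)] EX iW'//.
  have := iW (fun j => if unlift ord0 j is Some k then C k else A).
  rewrite !big_ord_recl/= unlift_none.
  under eq_bigr do rewrite liftK.
  under [in RHS]eq_bigr do rewrite liftK.
  by apply; move=> j; case: (unlift _ _).
- move=> _; rewrite -[ltLHS]/(m1 _) m1E.
  apply: (le_lt_trans (probability_le1 _ _)); last exact: ltry.
  by apply: measurableI => //; exact: measurableT.
Qed.

End gaussian_family.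

Section gaussian_family_integral.
Local Open Scope ereal_scope.
Context dT (T : measurableType dT) (R : realType) (P : probability T R).

(** The hypothesis on rectangles makes the joint law the product of [nu] and the law of [Y]; Tonelli
    then gives both the formula and the measurability of the inner integral. *)
Lemma ge0_integral_indep d1 d2 (T1 : measurableType d1) (T2 : measurableType d2)
    (nu : probability T1 R) (X : T -> T1) (Y : T -> T2) (F : T1 * T2 -> \bar R) :
  measurable_fun setT X -> measurable_fun setT Y ->
  (forall A B, measurable A -> measurable B ->
    P [set w | A (X w) /\ B (Y w)] = nu A * P [set w | B (Y w)]) ->
  measurable_fun setT F -> (forall z, 0 <= F z) ->
  measurable_fun setT (fun x => \int[P]_w F (x, Y w)) /\
  \int[P]_w F (X w, Y w) = \int[nu]_x \int[P]_w F (x, Y w).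
Proof.
move=> mX mY XY mF F0.
pose SY : {mfun T >-> T2} := HB.pack Y (isMeasurableFun.Build _ _ _ _ _ mY).
pose Z w := (X w, Y w).
have mZ : measurable_fun setT Z by exact/measurable_fun_pair.
pose SZ : {mfun T >-> (T1 * T2)%type} :=
  HB.pack Z (isMeasurableFun.Build _ _ _ _ _ mZ).
have FE x : \int[P]_w F (x, Y w) = \int[distribution P SY]_v F (x, v).
  rewrite ge0_integral_distribution//.
  by apply: measurableT_comp => //; exact: pair1_measurable.
split.
  under eq_fun do rewrite FE.
  exact: (@measurable_fun_fubini_tonelli_F _ _ _ _ R (distribution P SY)).
under [RHS]eq_integral do rewrite FE.
transitivity (\int[nu \x distribution P SY]_z F z); last first.
  exact: fubini_tonelli1.
transitivity (\int[distribution P SZ]_z F z).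
  by rewrite ge0_integral_distribution.
apply: eq_measure_integral => A mA _; apply/esym.
exact: product_measure_unique.
Qed.

Lemma ge0_integral_gaussian_family s n (W : 'I_n.+1 -> T -> R)
    (F : R * n.-tuple R -> \bar R) :
  gaussian_family P s W -> measurable_fun setT F -> (forall z, 0 <= F z) ->
  measurable_fun setT
    (fun x => \int[P]_w F (x, [tuple W (lift ord0 j) w | j < n])) /\
  \int[P]_w F (W ord0 w, [tuple W (lift ord0 j) w | j < n]) =
  \int[normal_prob 0 s]_x \int[P]_w F (x, [tuple W (lift ord0 j) w | j < n]).
Proof.
move=> gW mF F0; have [mW _] := gW.
have [mW' _] := gaussian_family_behead gW.
apply: (@ge0_integral_indep _ _ (measurableTypeR R) _ (normal_prob 0 s) (W ord0)) => //.
- exact: (mW ord0).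
- exact: measurable_mktuple.
- by move=> A B mA mB; exact: gaussian_family_indep.
Qed.

(** Induction on [n]. The one-variable inequality is applied to the integral over the remaining,
    already shifted coordinates, as a function of the first one; the induction hypothesis then
    bounds the power of that integral pointwise. The bound [M] keeps the partial integral
    real-valued. *)
Lemma gaussian_family_harnack (s a M : R) n (W : 'I_n -> T -> R) (h : 'I_n -> R)
    (G : n.-tuple R -> R) :
  (s != 0)%R -> (1 < a)%R -> gaussian_family P s W ->
  measurable_fun setT G -> (forall v, 0 <= G v <= M)%R ->
  (\int[P]_w (G [tuple (W j w + h j)%R | j < n])%:E) `^ a <=
  (expR (a / (a - 1) * ((\sum_(j < n) h j ^+ 2) / (s ^+ 2 *+ 2))))%:E *
  \int[P]_w (G [tuple W j w | j < n] `^ a)%:E.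
Proof.
move=> s0 a1; elim: n W h G => [W h G gW mG G0M|n IH W h G gW mG G0M].
  rewrite big_ord0 mul0r mulr0 expR0 mul1e.
  under eq_integral do rewrite tuple0.
  under [leRHS]eq_integral do rewrite tuple0.
  by rewrite !integral_cst//= probability_setT !mule1.
have a0 : (0 < a)%R by rewrite (lt_trans _ a1).
have gW' := gaussian_family_behead gW; have [mW' _] := gW'.
have G0 v : (0 <= G v)%R by case/andP: (G0M v).
have GM v : (G v <= M)%R by case/andP: (G0M v).
have mcons : measurable_fun setT
    (fun z : R * n.-tuple R => [tuple of z.1 :: z.2]).
  exact: measurable_cons.
pose hs (v : n.-tuple R) := [tuple (tnth v j + h (lift ord0 j))%R | j < n].
have mhs : measurable_fun setT hs.
  apply: measurable_mktuple => j; apply: measurable_funD => //.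
  exact: measurable_tnth.
pose F1 (z : R * n.-tuple R) := (G [tuple of z.1 :: hs z.2])%:E.
have mF1 : measurable_fun setT F1.
  apply/measurable_EFinP; apply: (measurableT_comp mG).
  apply: measurable_cons => //; exact: (measurableT_comp mhs).
pose F2 (z : R * n.-tuple R) := (G [tuple of z.1 :: z.2] `^ a)%:E.
have mF2 : measurable_fun setT F2.
  apply/measurable_EFinP; apply: (measurableT_comp (measurable_powR a)).
  exact: measurableT_comp.
pose F3 (z : R * n.-tuple R) := F1 ((z.1 + h ord0)%R, z.2).
have mF3 : measurable_fun setT F3.
  apply: (measurableT_comp mF1); apply/measurable_fun_pair => //=.
  exact: measurable_funD.
have F10 z : 0 <= F1 z by rewrite lee_fin.
have F20 z : 0 <= F2 z by rewrite lee_fin powR_ge0.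
(* [F3] holds the shift of the first coordinate, so that integrating it out produces
   [f (x + h ord0)]. *)
have F30 z : 0 <= F3 z by exact: F10.
pose X w := [tuple W (lift ord0 j) w | j < n].
have mX : measurable_fun setT X by exact: measurable_mktuple.
have hsX w : hs (X w) = [tuple (W (lift ord0 j) w + h (lift ord0 j))%R | j < n].
  by apply: eq_from_tnth => j; rewrite !tnth_mktuple.
have [mI1 _] := ge0_integral_gaussian_family gW mF1 F10.
have [mI2 I2] := ge0_integral_gaussian_family gW mF2 F20.
have [_ I3] := ge0_integral_gaussian_family gW mF3 F30.
pose f x := fine (\int[P]_w F1 (x, X w)).
have fE x : (f x)%:E = \int[P]_w F1 (x, X w).
  rewrite fineK// ge0_fin_numE; last by apply: integral_ge0.
  apply: (@le_lt_trans _ _ (\int[P]_w M%:E)); last first.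
    by rewrite integral_cst//= probability_setT mule1 ltry.
  apply: ge0_le_integral => //.
    apply: (measurableT_comp mF1); exact/measurable_fun_pair.
  by move=> w _; rewrite lee_fin.
have mf : measurable_fun setT f.
  by apply/measurable_EFinP; apply: eq_measurable_fun mI1 => x _ /=; rewrite fE.
have f0 x : (0 <= f x)%R by rewrite fine_ge0// integral_ge0.
have -> : \int[P]_w (G [tuple (W j w + h j)%R | j < n.+1])%:E =
    \int[normal_prob 0 s]_x (f (x + h ord0)%R)%:E.
  under [RHS]eq_integral do rewrite fE.
  rewrite -[RHS]I3; apply: eq_integral => w _; rewrite mktuple_recl.
  congr (G _)%:E; apply: val_inj => /=; congr (_ :: _).
  exact: esym (congr1 val (hsX w)).
apply: (le_trans (normal_prob_harnack _ s0 a1 mf f0)).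
have -> : \int[P]_w (G [tuple W j w | j < n.+1] `^ a)%:E =
    \int[normal_prob 0 s]_x \int[P]_w F2 (x, X w).
  rewrite -I2; apply: eq_integral => w _; rewrite /F2/=.
  by rewrite mktuple_recl.
rewrite big_ord_recl mulrDl mulrDr expRD EFinM -muleA.
apply: lee_wpmul2l; first by rewrite lee_fin expR_ge0.
rewrite -ge0_integralZl_EFin ?expR_ge0//; last first.
  by move=> x _; apply: integral_ge0.
apply: ge0_le_integral => //.
- by move=> x _; rewrite lee_fin powR_ge0.
- by apply/measurable_EFinP; exact: (measurableT_comp (measurable_powR a)).
- exact: measurable_funeM.
move=> x _.
have := IH (fun j => W (lift ord0 j)) (fun j => h (lift ord0 j))
  (fun v => G [tuple of x :: v]) gW'.
rewrite -poweR_EFin fE.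
under eq_integral do rewrite -hsX.
apply=> [|v]; last exact: G0M.
apply: (measurableT_comp mG).
exact: (measurableT_comp mcons (pair1_measurable x)).
Qed.
End gaussian_family_integral.

(** * Harnack inequality on a time grid *)

Section centred_sums.
Variable R : realFieldType.

(* Recentring the index makes affine shifts orthogonal to constants. *)
Definition centred (N k : nat) : R := k%:R - (N%:R - 1) / 2.

Lemma sum_natr N : \sum_(k < N) (k%:R : R) = N%:R * (N%:R - 1) / 2.
Proof.
elim: N => [|N IH]; first by rewrite big_ord0 !mul0r.
by rewrite big_ord_recr/= IH -natr1; field.
Qed.

Lemma sum_natr_sqr N :
  \sum_(k < N) (k%:R ^+ 2 : R) = N%:R * (N%:R - 1) * (2 * N%:R - 1) / 6.
Proof.
elim: N => [|N IH]; first by rewrite big_ord0 !mul0r.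
by rewrite big_ord_recr/= IH -natr1; field.
Qed.

Lemma sum_centred N : \sum_(k < N) centred N k = 0.
Proof.
by rewrite big_split/= sum_natr sumr_const card_ord -mulr_natl; field.
Qed.

Lemma sum_centred_sqr N :
  \sum_(k < N) centred N k ^+ 2 = N%:R * (N%:R ^+ 2 - 1) / 12.
Proof.
transitivity (\sum_(k < N) ((k%:R ^+ 2 : R) + (- (N%:R - 1)) * k%:R
                            + ((N%:R - 1) / 2) ^+ 2)).
  by apply: eq_bigr => k _; rewrite /centred; field.
rewrite !big_split/= -mulr_sumr sum_natr sum_natr_sqr sumr_const card_ord.
by rewrite -mulr_natl; field.
Qed.

Lemma sum_affine_centred N (a b : R) : (0 < N)%N ->
  \sum_(k < N) (a / N%:R + b * centred N k) = a.
Proof.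
move=> N0; rewrite big_split/= sumr_const card_ord -mulr_sumr sum_centred.
by rewrite mulr0 addr0 -[LHS]mulr_natr divfK// pnatr_eq0 -lt0n.
Qed.

Lemma sum_affine_centred_sqr N (a b : R) : (0 < N)%N ->
  \sum_(k < N) (a / N%:R + b * centred N k) ^+ 2 =
  a ^+ 2 / N%:R + b ^+ 2 * (N%:R * (N%:R ^+ 2 - 1) / 12).
Proof.
move=> N0; have N0' : N%:R != 0 :> R by rewrite pnatr_eq0 -lt0n.
transitivity (\sum_(k < N) ((a / N%:R) ^+ 2 + 2 * (a / N%:R) * b * centred N k
                            + b ^+ 2 * centred N k ^+ 2)).
  by apply: eq_bigr => k _; ring.
rewrite !big_split/= -!mulr_sumr sum_centred sum_centred_sqr sumr_const card_ord.
by rewrite -mulr_natl; field.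
Qed.

(** The weights pair mean with mean and slope with slope. As the plain sum fixes [a], the two
    endpoint constraints form a triangular system for [a] and [b]. *)
Lemma sum_weighted_affine_centred N (a b : R) : (0 < N)%N ->
  \sum_(k < N) (N%:R / 2 - centred N k) * (a / N%:R + b * centred N k) =
  N%:R / 2 * a - b * (N%:R * (N%:R ^+ 2 - 1) / 12).
Proof.
move=> N0; have N0' : N%:R != 0 :> R by rewrite pnatr_eq0 -lt0n.
transitivity (\sum_(k < N) (a / 2 + (b * N%:R / 2 - a / N%:R) * centred N k
                            + (- b) * centred N k ^+ 2)).
  by apply: eq_bigr => k _; field.
rewrite !big_split/= -!mulr_sumr sum_centred sum_centred_sqr sumr_const card_ord.
by rewrite -mulr_natl; field.
Qed.

(* Abel summation: since N / 2 - centred N k = N - k - 1 / 2, the trapezoidal sum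
   is linear in the increments, with weights centred at N / 2. *)
Lemma sum_weighted_increments N (b : nat -> R) : b 0%N = 0 ->
  \sum_(k < N) (N%:R / 2 - centred N k) * (b k.+1 - b k) =
  \sum_(k < N) b k + b N / 2.
Proof.
move=> b0.
have E M : \sum_(k < M) (k%:R : R) * (b k.+1 - b k) = M%:R * b M - \sum_(k < M) b k.+1.
  elim: M => [|M IH]; first by rewrite !big_ord0 mul0r subr0.
  by rewrite !big_ord_recr/= IH -natr1; ring.
transitivity (\sum_(k < N) (N%:R - 1 / 2) * (b k.+1 - b k) -
              \sum_(k < N) (k%:R : R) * (b k.+1 - b k)).
  by rewrite -sumrB; apply: eq_bigr => k _; rewrite /centred; field.
rewrite -mulr_sumr E -(big_mkord xpredT (fun k => b k.+1 - b k)) telescope_sumr// b0.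
have -> : \sum_(k < N) b k.+1 = \sum_(k < N) b k + b N.
  transitivity (\sum_(k < N.+1) b k); last by rewrite big_ord_recr.
  by rewrite big_ord_recl/= b0 add0r.
by field.
Qed.

End centred_sums.

Section brownian_grid.
Context (R : realType) (dT : measure_display) (T : measurableType dT).
Context (P : probability T R) (d : nat) (sigma t : R) (B : 'I_d -> R -> T -> R).
Hypotheses (sigma0 : 0 < sigma) (t0 : 0 < t) (BB : is_brownian_motion P sigma B).
Variable N : nat.

Notation I := #|{: 'I_N * 'I_d}|.

Definition grid (k : nat) : R := k%:R * (t / N%:R).

(** Pairs (time step, coordinate) are flattened to one ordinal, the index type of
    [gaussian_family]. *)
Definition grid_incr (j : 'I_I) (w : T) : R :=
  let: (k, i) := enum_val j in B i (grid k.+1) w - B i (grid k) w.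

Lemma grid_gaussian : (0 < N)%N ->
  gaussian_family P (sigma * Num.sqrt (t / N%:R)) grid_incr.
Proof.
move=> N0; have [B0 _ mB iB] := BB; split=> [j|A mA].
  rewrite /grid_incr; case: (enum_val j) => k i.
  by apply: measurable_funB; exact: mB.
have dt0 : 0 < t / N%:R by rewrite divr_gt0// ltr0n.
have gridS k : grid k.+1 - grid k = t / N%:R.
  by rewrite /grid -mulrBl -natr1 addrAC subrr add0r mul1r.
(* [is_brownian_motion] takes sets indexed by all naturals; beyond [N] any measurable default will
   do. *)
pose A' (k : nat) (i : 'I_d) : set R :=
  if insub k is Some k' then A (enum_rank (k' : 'I_N, i)) else setT.
have A'E (k : 'I_N) i : A' k i = A (enum_rank (k, i)) by rewrite /A' valK.
have := iB N grid A' _ _ _.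
under eq_bigr do under eq_bigr do rewrite A'E.
under [in RHS]eq_bigr do under eq_bigr do rewrite A'E gridS.
rewrite (_ : (\big[setI/setT]_(k < N) _) =
    \big[setI/setT]_(j < I) [set w | A j (grid_incr j w)]); last first.
  rewrite bigsetI_ord_setT [RHS]bigsetI_ord_setT; apply/seteqP; split => w /=.
    move=> h j; rewrite /grid_incr; case E : (enum_val j) => [k i].
    by have := h k; rewrite bigsetI_ord_setT => /(_ i)/=; rewrite -E enum_valK inE.
  move=> h k; rewrite bigsetI_ord_setT => i /=.
  by have := h (enum_rank (k, i)); rewrite /grid_incr enum_rankK inE.
move=> ->.
- rewrite pair_big/= [RHS](reindex enum_rank)/=; last exact/onW_bij/enum_rank_bij.
  by apply: eq_bigr => -[].
- by rewrite /grid mul0r.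
- by move=> k kN; rewrite -subr_gt0 gridS.
- by move=> k i; rewrite /A'; case: insubP.
Qed.

(** The discretised endpoint as an affine function of the increments, so a deterministic shift of
    [v] displaces it by a deterministic vector. *)
Definition grid_state (x : d.-tuple R * d.-tuple R) (v : I.-tuple R) :
    d.-tuple R * d.-tuple R :=
  ([tuple tnth x.1 i + \sum_(k < N) tnth v (enum_rank (k, i)) | i < d],
   [tuple tnth x.2 i + t * tnth x.1 i
      + t / N%:R * \sum_(k < N) (N%:R / 2 - centred R N k) * tnth v (enum_rank (k, i))
   | i < d]).

(** The paths vanish at 0, so giving the first node full rather than half weight changes nothing. *)
Definition trapezoid (b : R -> R) : R :=
  t / N%:R * (\sum_(k < N) b (grid k) + b t / 2).

Lemma grid_state_incr x w : (0 < N)%N ->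
  grid_state x [tuple grid_incr j w | j < I] =
  ([tuple tnth x.1 i + B i t w | i < d],
   [tuple tnth x.2 i + t * tnth x.1 i + trapezoid (B i ^~ w) | i < d]).
Proof.
move=> N0; have [B0 _ _ _] := BB.
have gridN : grid N = t by rewrite /grid mulrC divfK// pnatr_eq0 -lt0n.
have incrE k i : tnth [tuple grid_incr j w | j < I] (enum_rank (k, i)) =
    B i (grid k.+1) w - B i (grid k) w.
  by rewrite tnth_mktuple /grid_incr enum_rankK.
have grid0 i : B i (grid 0) w = 0 by rewrite /grid mul0r.
rewrite /grid_state; congr pair; apply: eq_mktuple => i; congr (_ + _).
  under eq_bigr do rewrite incrE.
  rewrite -(big_mkord xpredT (fun k => B i (grid k.+1) w - B i (grid k) w)).
  by rewrite telescope_sumr// gridN grid0 subr0.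
rewrite /trapezoid; congr (_ * _).
under eq_bigr do rewrite incrE.
by rewrite (@sum_weighted_increments R N (fun k => B i (grid k) w))// gridN.
Qed.

End brownian_grid.

Section grid_harnack.
Context (R : realType) (dT : measure_display) (T : measurableType dT).
Context (P : probability T R) (d : nat) (sigma t : R) (B : 'I_d -> R -> T -> R).
Hypotheses (sigma0 : 0 < sigma) (t0 : 0 < t) (BB : is_brownian_motion P sigma B).

Definition trapezoid_state N (x : d.-tuple R * d.-tuple R) (w : T) :
    d.-tuple R * d.-tuple R :=
  ([tuple tnth x.1 i + B i t w | i < d],
   [tuple tnth x.2 i + t * tnth x.1 i + trapezoid t N (B i ^~ w) | i < d]).

Lemma measurable_grid_state N (x : d.-tuple R * d.-tuple R) :
  measurable_fun setT (@grid_state R d t N x).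
Proof.
apply/measurable_fun_pair; apply: measurable_mktuple => i.
  apply: measurable_funD => //; apply: measurable_sum => k.
  exact: measurable_tnth.
apply: measurable_funD => //; apply: measurable_funM => //.
apply: measurable_sum => k; apply: measurable_funM => //.
exact: measurable_tnth.
Qed.

(** The exact cost on the grid. Only the slope part carries N^2 / (N^2 - 1), because the centred
    squares sum to N (N^2 - 1) / 12 instead of N^3 / 12. *)
Definition harnack_cost (N : nat) (x y : d.-tuple R * d.-tuple R) : R :=
  N%:R ^+ 2 / (N%:R ^+ 2 - 1) * (6 / (sigma ^+ 2 * t ^+ 3) *
    \sum_(i < d) (t / 2 * (tnth y.1 i - tnth x.1 i)
                  + (tnth y.2 i - tnth x.2 i)) ^+ 2)
  + 1 / (2 * sigma ^+ 2 * t) * \sum_(i < d) (tnth y.1 i - tnth x.1 i) ^+ 2.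

Lemma trapezoid_harnack N (a M : R) (phi : d.-tuple R * d.-tuple R -> R) x y :
  (1 < N)%N -> 1 < a -> measurable_fun setT phi -> (forall z, 0 <= phi z <= M) ->
  ((\int[P]_w (phi (trapezoid_state N x w))%:E) `^ a <=
   (expR (a / (a - 1) * harnack_cost N x y))%:E *
   \int[P]_w (phi (trapezoid_state N y w) `^ a)%:E)%E.
Proof.
move=> N1 a1 mphi phi0M.
have N0 : (0 < N)%N by exact: ltnW.
have Nn0 : N%:R != 0 :> R by rewrite pnatr_eq0 -lt0n.
(* This is where two steps are needed: a single increment cannot meet both endpoint constraints. *)
have N21 : N%:R ^+ 2 - 1 != 0 :> R.
  by rewrite gt_eqF// subr_gt0 expr_gt1// ?ltr1n// ler0n.
(* The slope b of the shift is determined by the two endpoint constraints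
   sum h = p and t / N * sum (N / 2 - centred) * h = c. *)
pose p i := tnth x.1 i - tnth y.1 i.
pose c i := (tnth x.2 i - tnth y.2 i) + t * p i.
pose b i := 12 * (t * p i / 2 - c i) / (t * (N%:R ^+ 2 - 1)).
pose h (j : 'I_#|{: 'I_N * 'I_d}|) := let: (k, i) := enum_val j in
  p i / N%:R + b i * centred R N k.
have hE k i : h (enum_rank (k, i)) = p i / N%:R + b i * centred R N k.
  by rewrite /h enum_rankK.
(* Shifted increments started at [y] end exactly where unshifted ones started at [x] do, so the
   shifted side of the Harnack inequality is the one at [x]. *)
have shiftE w : @grid_state R d t N y [tuple (grid_incr t B j w + h j) | j < #|{: 'I_N * 'I_d}|] =
    trapezoid_state N x w.
  rewrite /trapezoid_state -(grid_state_incr t BB)// /grid_state; congr pair; apply: eq_mktuple => i.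
    under eq_bigr do rewrite tnth_mktuple hE.
    under [in RHS]eq_bigr do rewrite tnth_mktuple.
    rewrite big_split/= sum_affine_centred// /p.
    by ring.
  under eq_bigr do rewrite tnth_mktuple hE mulrDr.
  under [in RHS]eq_bigr do rewrite tnth_mktuple.
  rewrite big_split/= sum_weighted_affine_centred// mulrDr.
  rewrite /b /c /p; field.
  by rewrite Nn0 N21 gt_eqF.
have s0 : sigma * Num.sqrt (t / N%:R) != 0.
  by rewrite gt_eqF// mulr_gt0// sqrtr_gt0 divr_gt0// ltr0n.
have := gaussian_family_harnack h s0 a1 (grid_gaussian t0 BB N0)
  (measurableT_comp mphi (@measurable_grid_state N y)) (fun v => phi0M _).
under eq_integral do rewrite /= shiftE.
under [X in (_ <= _ * X)%E -> _]eq_integral do rewrite /= (grid_state_incr t BB)//.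
rewrite (_ : _ / (_ *+ 2) = harnack_cost N x y)//.
have -> : \sum_(j < #|{: 'I_N * 'I_d}|) h j ^+ 2 =
    \sum_(i < d) (p i ^+ 2 / N%:R + b i ^+ 2 * (N%:R * (N%:R ^+ 2 - 1) / 12)).
  under [RHS]eq_bigr do rewrite -sum_affine_centred_sqr//.
  rewrite exchange_big pair_big/= (reindex enum_rank)/=; last exact/onW_bij/enum_rank_bij.
  by apply: eq_bigr => -[k i] _; rewrite hE.
rewrite exprMn sqr_sqrtr; last by rewrite divr_ge0// ltW.
rewrite /harnack_cost mulr_suml !mulr_sumr -big_split/=.
apply: eq_bigr => i _; rewrite /b /c /p; field.
by rewrite Nn0 N21 !gt_eqF.
Qed.
End grid_harnack.

(** * Passage to the limit for continuous functions *)

Section riemann_sum.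
Variables (R : realType) (t : R) (b : R -> R).
Hypotheses (t0 : 0 < t) (cb : {within `[0, +oo[, continuous b}).
Notation mu := (@lebesgue_measure R).

Let step N (k : nat) : set R := `[k%:R * (t / N%:R), k.+1%:R * (t / N%:R)[%classic.

Let step_fun N (s : R) : R := \sum_(k < N) b (k%:R * (t / N%:R)) * \1_(step N k) s.

Let dt0 N : (0 < N)%N -> 0 < t / N%:R.
Proof. by move=> N0; rewrite divr_gt0// ltr0n. Qed.

(** Exactly one cell contains [s], with index the integer part of s / (t / N); the step function
    samples [b] at its left end, less than one mesh away. *)
Let step_fun_eq N s : (0 < N)%N -> 0 <= s < t ->
  exists k : nat, step_fun N s = b (k%:R * (t / N%:R)) /\
    s - t / N%:R < k%:R * (t / N%:R) <= s.
Proof.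
move=> N0 /andP[s0 st]; have d0 := dt0 N0.
have Nr0 : 0 < N%:R :> R by rewrite ltr0n.
pose k := Num.truncn (s / (t / N%:R)).
have /andP[ks sk] : k%:R <= s / (t / N%:R) < k.+1%:R.
  by rewrite Num.Theory.truncn_itv// divr_ge0// ltW.
have {}ks : k%:R * (t / N%:R) <= s by rewrite -ler_pdivlMr.
have {}sk : s < k.+1%:R * (t / N%:R) by rewrite -ltr_pdivrMr.
have kN : (k < N)%N.
  rewrite -(ltr_nat R) -(ltr_pM2r d0) (le_lt_trans ks)// (lt_le_trans st)//.
  by rewrite mulrC divfK// gt_eqF.
exists k; split; last first.
  by rewrite ks andbT ltrBlDr; move: sk; rewrite -natr1 mulrDl mul1r.
rewrite /step_fun (bigD1 (Ordinal kN))//= indicE mem_set ?mulr1; last first.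
  by rewrite /step/= in_itv/= ks sk.
rewrite big1 ?addr0// => j /eqP jk; rewrite indicE memNset ?mulr0//.
rewrite /step/= in_itv/= => /andP[js sj]; apply: jk; apply/val_inj => /=.
by apply/eqP; rewrite eqn_leq; apply/andP; split;
  rewrite -ltnS -(ltr_nat R) -(ltr_pM2r d0);
  [exact: le_lt_trans js sk|exact: le_lt_trans ks sj].
Qed.

(** The sum is the integral of [step_fun], which converges pointwise by continuity of [b] and is
    dominated by the bound of [b] on the compact interval. *)
Lemma riemann_sum_cvg :
  (fun N => t / N%:R * \sum_(k < N) b (k%:R * (t / N%:R))) @ \oo -->
  Rintegral mu `[0, t] b.
Proof.
have cbt : {within `[0, t], continuous b}.
  apply: continuous_subspaceW cb => s /=; rewrite !in_itv/= => /andP[-> _].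
  by [].
have [M bM] : exists M : R, forall s, 0 <= s <= t -> `|b s| <= M.
  have /compact_bounded[M [_ bM]] := continuous_compact cbt (@segment_compact _ 0 t).
  exists (M + 1) => s st; apply: (bM (M + 1)); first by rewrite ltrDl ltr01.
  by exists s => //=; rewrite in_itv.
have ib : mu.-integrable `[0, t] (EFin \o b).
  apply: continuous_compact_integrable => //; exact: segment_compact.
have ib' : mu.-integrable `[0, t[ (EFin \o b).
  apply: integrableS ib => // s /=; rewrite !in_itv/= => /andP[-> /ltW ->]. by [].
(* The half-open cells leave out the point [t], which is a null set. *)
rewrite -Rintegral_itv_bndo_bndc//.
have mstep N : measurable_fun setT (step_fun N).
  apply: measurable_sum => k; apply: measurable_funM => //.
  by apply: measurable_indic; exact: measurable_itv.
have icst c : mu.-integrable `[0, t[ (EFin \o cst c).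
  have ic : mu.-integrable `[0, t] (EFin \o cst c).
    apply: continuous_compact_integrable; first exact: segment_compact.
    by apply: continuous_subspaceT => s; exact: cvg_cst.
  by apply: integrableS ic => // s /=; rewrite !in_itv/= => /andP[-> /ltW ->].
have istep N k : mu.-integrable `[0, t[ (fun s => (\1_(step N k) s)%:E).
  apply: le_integrable (icst 1) => //.
    apply/measurable_EFinP; apply: measurable_funTS; apply: measurable_indic.
    exact: measurable_itv.
  by move=> s _; rewrite lee_fin /= normr1 indicE; case: (_ \in _); rewrite ?normr1 ?normr0.
have stepE N : (0 < N)%N -> (\int[mu]_(s in `[0%R, t[) (step_fun N s)%:E)%E =
   (t / N%:R * \sum_(k < N) b (k%:R * (t / N%:R)))%:E.
  move=> N0; have d0 := dt0 N0.
  under eq_integral do rewrite /step_fun -sumEFin.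
  rewrite integral_sum//; last first.
    by move=> k; exact: (integrableZl _ (b (k%:R * (t / N%:R))) (istep N k)).
  rewrite mulr_sumr -sumEFin; apply: eq_bigr => k _.
  rewrite [LHS](integralZl _ (istep N k))//.
  rewrite integral_indic//; last exact: measurable_itv.
  rewrite setIidl; last first.
    move=> s /=; rewrite /step/= !in_itv/= => /andP[h1 h2].
    apply/andP; split; first by rewrite (le_trans _ h1)// mulr_ge0// ltW.
    apply: (lt_le_trans h2); rewrite mulrCA -[leRHS]mulr1 ler_pM2l//.
    by rewrite ler_pdivrMr ?ltr0n// mul1r ler_nat.
  have muE : mu (step N k) = (t / N%:R)%:E.
    rewrite /step lebesgue_measure_itv/= lte_fin ltr_pM2r// ltr_nat ltnSn.
    by rewrite -EFinB -mulrBl -natr1 addrAC subrr add0r mul1r.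
  by rewrite [X in (_ * X)%E]muE -EFinM mulrC.
have [] := @dominated_convergence _ _ _ mu `[0, t[%classic _
  (fun N s => (step_fun N.+1 s)%:E) (EFin \o b) (cst M%:E).
- by [].
- move=> N; apply/measurable_EFinP; apply: measurable_funTS; exact: mstep.
- exact: measurable_int ib'.
- apply/nearW => s /=; rewrite in_itv/= => st.
  apply: cvg_EFin; first by near=> N.
  have s0 : `[0, +oo[%classic s by rewrite /= in_itv/= andbT; case/andP: st.
  apply/cvgrPdist_lt => e e0.
  have /cvgrPdist_lt/(_ e e0) := (subspace_continuousP _ _).1 cb s s0.
  rewrite near_withinE => /nbhs_ballP[r /= r0 hr].
  near=> N.
  have [k [/= -> /andP[h1 h2]]] := step_fun_eq (ltn0Sn N) st.
  apply: hr; last by rewrite /= in_itv/= andbT mulr_ge0// ltW// dt0.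
  rewrite /ball/= ger0_norm ?subr_ge0// ltrBlDl -ltrBlDr (lt_trans _ h1)//.
  rewrite ltrD2l ltrN2 -ltr_pdivlMl// mulrC.
  near: N; exact: (near_infty_natSinv_lt (PosNum (divr_gt0 r0 t0))).
- exact: icst.
- apply/nearW => s N /=; rewrite in_itv/= => st.
  have [k [-> /andP[_ ks]]] := step_fun_eq (ltn0Sn N) st.
  rewrite lee_fin bM//; apply/andP; split.
    by rewrite mulr_ge0// ltW// dt0.
  by rewrite (le_trans ks)// ltW//; case/andP: st.
move=> _ _; rewrite -(fineK (integrable_fin_num _ ib'))//.
move=> /fine_cvgP[_].
rewrite -[X in _ -> X]cvg_shiftS /=.
rewrite (_ : fine \o _ = fun N => t / N.+1%:R * \sum_(k < N.+1) b (k%:R * (t / N.+1%:R)))//.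
by apply/funext => N /=; rewrite stepE.
Unshelve. all: by end_near.
Qed.
End riemann_sum.

(** For [l > 0] the power is differentiable, hence continuous, at [l]. At [l = 0] the threshold
    e^(1/a) is used directly. *)
Lemma cvg_powR (R : realType) (a l : R) (u : R^nat) : 0 < a ->
  (forall n, 0 <= u n) -> u @ \oo --> l -> u n `^ a @[n --> \oo] --> l `^ a.
Proof.
move=> a0 u0 ul.
have : 0 <= l by apply: (cvgr_to_ge ul); exact: nearW.
rewrite le_eqVlt => /predU1P[l0|l0].
  rewrite -l0 powR0 ?gt_eqF//; apply/cvgrPdist_lt => e e0.
  have ea0 : 0 < e `^ a^-1 by rewrite powR_gt0.
  have /cvgrPdist_lt/(_ _ ea0) := ul; apply: filterS => n.
  rewrite -l0 !sub0r !normrN !ger0_norm ?powR_ge0// => une.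
  rewrite -[ltRHS](powRr1 (ltW e0)) -(mulVf (lt0r_neq0 a0)) powRrM.
  by apply: gt0_ltr_powR => //; rewrite nnegrE ?u0 ?ltW.
have lin : l \in `]0, +oo[ by rewrite in_itv/= l0.
have /derivable1_diffP/differentiable_continuous := @derivable_powR R 1 a l lin.
by move/continuous_cvg; apply.
Qed.

Lemma bounded_integrable d (T : measurableType d) (R : realType)
    (P : probability T R) (g : T -> R) (M : R) :
  measurable_fun setT g -> (forall w, 0 <= g w <= M) ->
  P.-integrable setT (EFin \o g).
Proof.
move=> mg g0M.
apply: (le_integrable measurableT _ _ (finite_measure_integrable_cst P M measurableT)).
  exact/measurable_EFinP.
move=> w _; rewrite lee_fin; have /andP[g0 gM] := g0M w.
by rewrite !ger0_norm ?(le_trans g0).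
Qed.

Lemma cvg_sqr_ratio (R : realType) :
  (fun n => n.+2%:R ^+ 2 / (n.+2%:R ^+ 2 - 1)) @ \oo --> (1 : R).
Proof.
apply/cvgrPdist_lt => e e0; near=> n.
have n1 : n.+1%:R <= n.+2%:R ^+ 2 - 1 :> R.
  have : 0 <= n%:R :> R by [].
  by rewrite -!natr1; nra.
have n0 : 0 < n.+1%:R :> R by rewrite ltr0n.
have N0 := lt_le_trans n0 n1.
have -> : 1 - n.+2%:R ^+ 2 / (n.+2%:R ^+ 2 - 1) = - (n.+2%:R ^+ 2 - 1)^-1 :> R.
  by move: (n.+2%:R) N0 => N N0; field; rewrite gt_eqF.
rewrite normrN ger0_norm ?invr_ge0 ?(ltW N0)//.
apply: (@le_lt_trans _ _ n.+1%:R^-1); first by rewrite lef_pV2.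
by near: n; exact: (near_infty_natSinv_lt (PosNum e0)).
Unshelve. all: by end_near. Qed.

Section continuous_harnack.
Context (R : realType) (dT : measure_display) (T : measurableType dT).
Context (P : probability T R) (d : nat) (sigma t : R) (B : 'I_d -> R -> T -> R).
Hypotheses (sigma0 : 0 < sigma) (t0 : 0 < t) (BB : is_brownian_motion P sigma B).

Notation S := (d.-tuple R * d.-tuple R)%type.

Definition kolmogorov_state (x : S) (w : T) : S :=
  ([tuple tnth x.1 i + B i t w | i < d],
   [tuple tnth x.2 i + t * tnth x.1 i
      + Rintegral lebesgue_measure `[0, t] (fun s => B i s w) | i < d]).

(** Sequences and coordinates match the form in which pathwise convergence of the trapezoidal states
    arrives. *)
Definition seq_continuous (phi : S -> R) := forall (z_ : nat -> S) (z : S),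
  (forall i, tnth (z_ n).1 i @[n --> \oo] --> tnth z.1 i) ->
  (forall i, tnth (z_ n).2 i @[n --> \oo] --> tnth z.2 i) ->
  phi (z_ n) @[n --> \oo] --> phi z.

Lemma trapezoid_cvg i w :
  trapezoid t n (B i ^~ w) @[n --> \oo] -->
  Rintegral lebesgue_measure `[0, t] (fun s => B i s w).
Proof.
have [_ cB _ _] := BB.
have tn0 : t / n%:R @[n --> \oo] --> 0.
  apply/cvgrPdist_lt => e e0; near=> n.
  have n0 : 0 < n%:R :> R by rewrite ltr0n; near: n; exact: nbhs_infty_gt.
  rewrite sub0r normrN ger0_norm ?divr_ge0 ?ltW// ltr_pdivrMr//.
  rewrite mulrC -ltr_pdivrMr//; near: n; exact: nbhs_infty_gtr.
rewrite /trapezoid; under eq_fun do rewrite mulrDr.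
rewrite -[Rintegral _ _ _]addr0; apply: cvgD; first exact: riemann_sum_cvg.
have := cvgMr_tmp (b := B i t w / 2) tn0; rewrite mul0r; exact.
Unshelve. all: by end_near. Qed.

Lemma measurable_trapezoid n i : measurable_fun setT (fun w => trapezoid t n (B i ^~ w)).
Proof.
have [_ _ mB _] := BB.
apply: measurable_funM => //; apply: measurable_funD; last exact: measurable_funM.
by apply: measurable_sum => k; exact: mB.
Qed.

Lemma measurable_trapezoid_state n x : measurable_fun setT (trapezoid_state t B n x).
Proof.
have [_ _ mB _] := BB.
apply/measurable_fun_pair; apply: measurable_mktuple => i.
  by apply: measurable_funD => //; exact: mB.
by apply: measurable_funD => //; exact: measurable_trapezoid.
Qed.

(** Measurability of the pathwise integral in [w] is not assumed: it follows because the integral is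
    a pointwise limit of measurable trapezoidal sums. *)
Lemma measurable_kolmogorov_state x : measurable_fun setT (kolmogorov_state x).
Proof.
have [_ _ mB _] := BB.
apply/measurable_fun_pair; apply: measurable_mktuple => i.
  by apply: measurable_funD => //; exact: mB.
apply: measurable_funD => //.
apply: measurable_fun_cvg => [n|w _]; last exact: trapezoid_cvg.
exact: measurable_trapezoid.
Qed.

Lemma cvg_trapezoid_state (phi : S -> R) (M : R) x : measurable_fun setT phi ->
  (forall z, 0 <= phi z <= M) -> seq_continuous phi ->
  fine (\int[P]_w (phi (trapezoid_state t B n x w))%:E)%E @[n --> \oo] -->
  fine (\int[P]_w (phi (kolmogorov_state x w))%:E)%E.
Proof.
move=> mphi phi0M cphi.
have [] := @dominated_convergence _ _ _ P setT measurableT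
  (fun n w => (phi (trapezoid_state t B n x w))%:E)
  (fun w => (phi (kolmogorov_state x w))%:E) (cst M%:E).
- move=> n; apply/measurable_EFinP; apply: (measurableT_comp mphi).
  exact: measurable_trapezoid_state.
- apply/measurable_EFinP; apply: (measurableT_comp mphi).
  exact: measurable_kolmogorov_state.
- apply/nearW => w _; apply: cvg_EFin; first by near=> n.
  apply: cphi => i.
    by under eq_fun do rewrite tnth_mktuple; rewrite tnth_mktuple; exact: cvg_cst.
  under eq_fun do rewrite tnth_mktuple; rewrite tnth_mktuple.
  by apply: cvgD; [exact: cvg_cst|exact: trapezoid_cvg].
- exact: finite_measure_integrable_cst.
- apply/nearW => w n _; have /andP[p0 pM] := phi0M (trapezoid_state t B n x w).
  by rewrite lee_fin ger0_norm.
move=> iphi _; rewrite -(fineK (integrable_fin_num _ iphi))//.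
by move=> /fine_cvgP[_].
Unshelve. all: by end_near. Qed.

Lemma seq_continuous_harnack (a M : R) (phi : S -> R) x y :
  1 < a -> measurable_fun setT phi -> (forall z, 0 <= phi z <= M) ->
  seq_continuous phi ->
  fine (\int[P]_w (phi (kolmogorov_state x w))%:E)%E `^ a <=
  C_alpha sigma a t x y *
  fine (\int[P]_w (phi (kolmogorov_state y w) `^ a)%:E)%E.
Proof.
move=> a1 mphi phi0M cphi.
have a0 : 0 < a by rewrite (lt_trans _ a1).
have phi0 z : 0 <= phi z by case/andP: (phi0M z).
have phiM z : phi z <= M by case/andP: (phi0M z).
have phia0M z : 0 <= phi z `^ a <= M `^ a.
  rewrite powR_ge0/=; apply: ge0_ler_powR => //; rewrite ?nnegrE ?(ltW a0)//.
  exact: le_trans (phiM z).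
have cphia : seq_continuous (fun z => phi z `^ a).
  by move=> z_ z h1 h2; apply: cvg_powR => //; exact: cphi.
have mphia : measurable_fun setT (fun z => phi z `^ a).
  exact: (measurableT_comp (measurable_powR a)).
set u := fine _; set v := fine _.
have un0 n : 0 <= fine (\int[P]_w (phi (trapezoid_state t B n x w))%:E)%E.
  by apply: fine_ge0; apply: integral_ge0 => w _; rewrite lee_fin.
have cu := cvg_powR a0 un0 (cvg_trapezoid_state (x := x) mphi phi0M cphi).
have cv := cvg_trapezoid_state (x := y) mphia phia0M cphia.
have cC : expR (a / (a - 1) * harnack_cost sigma t n.+2 x y) @[n --> \oo] -->
    C_alpha sigma a t x y.
  apply: continuous_cvg; first exact: continuous_expR.
  apply: cvgMl_tmp; rewrite /harnack_cost; apply: cvgD; last exact: cvg_cst.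
  have := cvgMr_tmp (b := 6 / (sigma ^+ 2 * t ^+ 3) *
    \sum_(i < d) (t / 2 * (tnth y.1 i - tnth x.1 i)
                  + (tnth y.2 i - tnth x.2 i)) ^+ 2) (@cvg_sqr_ratio R).
  rewrite mul1r; exact.
(* The grid inequality starts at two steps, so every sequence is read from index 2. *)
have shift2 (f : R^nat) (l : R) : f @ \oo --> l -> f n.+2 @[n --> \oo] --> l.
  by rewrite -(cvg_shiftn 2 f); under eq_fun do rewrite addn2.
apply: (ler_cvg_to (shift2 _ _ cu) (cvgM cC (shift2 _ _ cv))).
apply: nearW => n /=.
have := @trapezoid_harnack _ _ _ P d sigma t B sigma0 t0 BB n.+2 a M phi x y isT a1 mphi phi0M.
have fx : (\int[P]_w (phi (trapezoid_state t B n.+2 x w))%:E)%E \is a fin_num.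
  apply: integrable_fin_num => //; apply: (bounded_integrable P _ (fun w => phi0M _)).
  exact: (measurableT_comp mphi (measurable_trapezoid_state n.+2 x)).
have fy : (\int[P]_w (phi (trapezoid_state t B n.+2 y w) `^ a)%:E)%E \is a fin_num.
  apply: integrable_fin_num => //; apply: (bounded_integrable P _ (fun w => phia0M _)).
  exact: (measurableT_comp mphia (measurable_trapezoid_state n.+2 y)).
move=> H; rewrite -lee_fin EFinM -poweR_EFin (fineK fx) (fineK fy).
exact: H.
Qed.
End continuous_harnack.

(** * Extension to bounded Borel functions *)

Section sequentially_continuous.
Variables (R : realType) (d : nat).
Notation S := (d.-tuple R * d.-tuple R)%type.
Implicit Types phi psi : S -> R.

Lemma seq_continuous_cst c : seq_continuous (fun=> c : R) (d := d).
Proof. by move=> ? ? _ _; exact: cvg_cst. Qed.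

Lemma seq_continuousD phi psi : seq_continuous phi -> seq_continuous psi ->
  seq_continuous (fun z => phi z + psi z).
Proof.
by move=> c1 c2 z_ z h1 h2; apply: cvgD; [exact: c1|exact: c2].
Qed.

Lemma seq_continuousM phi psi : seq_continuous phi -> seq_continuous psi ->
  seq_continuous (fun z => phi z * psi z).
Proof.
by move=> c1 c2 z_ z h1 h2; apply: cvgM; [exact: c1|exact: c2].
Qed.

Lemma seq_continuous_norm phi : seq_continuous phi ->
  seq_continuous (fun z => `|phi z|).
Proof. by move=> c1 z_ z h1 h2; apply: cvg_norm; exact: c1. Qed.

Lemma seq_continuous_min phi psi : seq_continuous phi -> seq_continuous psi ->
  seq_continuous (fun z => Num.min (phi z) (psi z)).
Proof.
move=> c1 c2; under eq_fun do rewrite minr_absE -mulN1r.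
apply: seq_continuousM; last exact: seq_continuous_cst.
apply: seq_continuousD; first exact: seq_continuousD.
apply: seq_continuousM; first exact: seq_continuous_cst.
apply: seq_continuous_norm; apply: seq_continuousD => //.
under eq_fun do rewrite -mulN1r.
by apply: seq_continuousM => //; exact: seq_continuous_cst.
Qed.

Lemma seq_continuous_max phi psi : seq_continuous phi -> seq_continuous psi ->
  seq_continuous (fun z => Num.max (phi z) (psi z)).
Proof.
move=> c1 c2; under eq_fun do rewrite maxr_absE.
apply: seq_continuousM; last exact: seq_continuous_cst.
apply: seq_continuousD; first exact: seq_continuousD.
apply: seq_continuous_norm; apply: seq_continuousD => //.
under eq_fun do rewrite -mulN1r.
by apply: seq_continuousM => //; exact: seq_continuous_cst.
Qed.

End sequentially_continuous.

Lemma ler_dist_min (R : realDomainType) (a b c d : R) :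
  `|Num.min a b - Num.min c d| <= `|a - c| + `|b - d|.
Proof.
have := (ler_norm (a - c), ler_norm (c - a), ler_norm (b - d), ler_norm (d - b)).
rewrite (distrC c a) (distrC d b) => -[[[h1 h2] h3] h4].
have := (normr_ge0 (a - c), normr_ge0 (b - d)) => -[h5 h6].
rewrite ler_norml; apply/andP; split; case: (ltP a b); case: (ltP c d); lra.
Qed.

Section approximation.
Context (R : realType) (dT : measure_display) (T : measurableType dT).
Context (P : probability T R) (d : nat).
Notation S := (d.-tuple R * d.-tuple R)%type.
Variables X Y : T -> S.
Hypotheses (mX : measurable_fun setT X) (mY : measurable_fun setT Y).

(** With [X] and [Y] the states started at the two points, one approximant in this seminorm serves
    both sides of the inequality. *)
Definition norm1 (g : S -> R) : \bar R :=
  (\int[P]_w (`|g (X w)| + `|g (Y w)|)%:E)%E.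

Let mnorm1 (g : S -> R) : measurable_fun setT g ->
  measurable_fun setT (fun w => (`|g (X w)| + `|g (Y w)|)%:E).
Proof.
move=> mg; apply/measurable_EFinP; apply: measurable_funD;
  apply: measurableT_comp => //; exact: measurableT_comp.
Qed.

Lemma norm1_ge0 g : (0 <= norm1 g)%E.
Proof. by apply: integral_ge0 => w _; rewrite lee_fin addr_ge0. Qed.

Lemma le_norm1D (g h1 h2 : S -> R) : measurable_fun setT g -> measurable_fun setT h1 ->
  measurable_fun setT h2 -> (forall z, `|g z| <= `|h1 z| + `|h2 z|) ->
  (norm1 g <= norm1 h1 + norm1 h2)%E.
Proof.
move=> mg m1 m2 gh; rewrite -ge0_integralD//; [|exact: mnorm1..].
apply: ge0_le_integral => //; first exact: mnorm1.
  by apply: emeasurable_funD; exact: mnorm1.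
by move=> w _; rewrite -EFinD lee_fin addrACA lerD.
Qed.

Lemma norm1Z (c : R) (g : S -> R) : measurable_fun setT g ->
  norm1 (fun z => c * g z) = (`|c|%:E * norm1 g)%E.
Proof.
move=> mg; rewrite -ge0_integralZl_EFin//.
- by apply: eq_integral => w _; rewrite !normrM -mulrDr.
- exact: mnorm1.
Qed.

Definition approximable (g : S -> R) := measurable_fun setT g /\
  forall e : R, 0 < e -> exists phi : S -> R,
    [/\ measurable_fun setT phi, seq_continuous phi &
        (norm1 (fun z => g z - phi z)%R <= e%:E)%E].

Lemma seq_continuous_approximable phi : measurable_fun setT phi ->
  seq_continuous phi -> approximable phi.
Proof.
move=> mphi cphi; split=> // e e0; exists phi; split => //.
rewrite /norm1; under eq_integral do rewrite !subrr normr0 addr0.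
by rewrite integral0 lee_fin ltW.
Qed.

Lemma approximable_cst c : approximable (fun=> c).
Proof.
by apply: seq_continuous_approximable => //; exact: seq_continuous_cst.
Qed.

Lemma approximableD g h : approximable g -> approximable h ->
  approximable (fun z => g z + h z).
Proof.
move=> [mg ag] [mh ah]; split=> [|e e0]; first exact: measurable_funD.
have e20 : 0 < e / 2 by rewrite divr_gt0.
have [phi [mphi cphi gphi]] := ag _ e20.
have [psi [mpsi cpsi hpsi]] := ah _ e20.
exists (fun z => phi z + psi z); split.
- exact: measurable_funD.
- exact: seq_continuousD.
rewrite (splitr e) EFinD; apply: le_trans (leeD gphi hpsi).
apply: le_norm1D.
- by apply: measurable_funB; exact: measurable_funD.
- exact: measurable_funB.
- exact: measurable_funB.
by move=> z; rewrite opprD addrACA ler_normD.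
Qed.

Lemma approximable_min g h : approximable g -> approximable h ->
  approximable (fun z => Num.min (g z) (h z)).
Proof.
move=> [mg ag] [mh ah]; split=> [|e e0]; first exact: measurable_minr.
have e20 : 0 < e / 2 by rewrite divr_gt0.
have [phi [mphi cphi gphi]] := ag _ e20.
have [psi [mpsi cpsi hpsi]] := ah _ e20.
exists (fun z => Num.min (phi z) (psi z)); split.
- exact: measurable_minr.
- exact: seq_continuous_min.
rewrite (splitr e) EFinD; apply: le_trans (leeD gphi hpsi).
apply: le_norm1D.
- by apply: measurable_funB; exact: measurable_minr.
- exact: measurable_funB.
- exact: measurable_funB.
by move=> z; exact: ler_dist_min.
Qed.

Lemma approximableZ c g : approximable g -> approximable (fun z => c * g z).
Proof.
move=> [mg ag]; split=> [|e e0]; first exact: measurable_funM.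
have c0 : 0 < `|c| + 1 by rewrite ltr_wpDl.
have [phi [mphi cphi gphi]] := ag _ (divr_gt0 e0 c0).
exists (fun z => c * phi z); split; first exact: measurable_funM.
  by apply: seq_continuousM => //; exact: seq_continuous_cst.
rewrite [norm1 _](_ : _ = norm1 (fun z => c * (g z - phi z))); last first.
  by congr norm1; apply/funext => z; rewrite mulrBr.
rewrite norm1Z; last exact: measurable_funB.
apply: (@le_trans _ _ (`|c|%:E * (e / (`|c| + 1))%:E)%E).
  by rewrite lee_wpmul2l// lee_fin.
rewrite -EFinM lee_fin mulrA ler_pdivrMr// mulrC ler_pM2l//.
by rewrite lerDl.
Qed.

(** The uniform bound gives dominated convergence of [g_ n] to [g] in [norm1]; an approximant of a
    late [g_ n] to within e / 2 then approximates [g]. *)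
Lemma approximable_cvg (g_ : nat -> S -> R) (g : S -> R) (K : R) :
  (forall n, approximable (g_ n)) -> (forall n z, `|g_ n z| <= K) ->
  (forall z, g_ n z @[n --> \oo] --> g z) -> approximable g.
Proof.
move=> ag gK gcvg.
have mg_ n : measurable_fun setT (g_ n) by case: (ag n).
have mg : measurable_fun setT g by apply: measurable_fun_cvg => // z _; exact: gcvg.
have gK' z : `|g z| <= K.
  by apply: (cvgr_to_le (cvg_norm (gcvg z))); exact: nearW.
have dist0 z : `|g_ n z - g z| @[n --> \oo] --> (0 : R).
  rewrite -(normr0 R) -(subrr (g z)); apply: cvg_norm.
  by apply: cvgB; [exact: gcvg|exact: cvg_cst].
have cn : norm1 (fun z => g_ n z - g z) @[n --> \oo] --> 0%E.
  have [] := @dominated_convergence _ _ _ P setT measurableT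
    (fun n w => (`|g_ n (X w) - g (X w)| + `|g_ n (Y w) - g (Y w)|)%:E)
    (cst 0%E) (cst (K + K + (K + K))%:E).
  - by move=> n; apply: (mnorm1 (g := fun z => g_ n z - g z)); exact: measurable_funB.
  - exact: measurable_cst.
  - apply/nearW => w _; apply: cvg_EFin; first by near=> n.
    by rewrite -[0 in X in _ --> X]addr0; apply: cvgD; exact: dist0.
  - exact: finite_measure_integrable_cst.
  - apply/nearW => w n _; rewrite lee_fin ger0_norm ?addr_ge0//.
    by rewrite lerD// (le_trans (ler_normB _ _))// lerD.
  by move=> _ _; rewrite integral0.
split=> // e e0.
have e20 : 0 < e / 2 by rewrite divr_gt0.
have [n gn] : exists n, (norm1 (fun z => g_ n z - g z)%R <= (e / 2)%:E)%E.
  have /fine_cvgP[fin /cvgrPdist_lt/(_ _ e20) small] := cn.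
  have [n [/fineK nfin]] := filter_ex (filterI fin small).
  rewrite sub0r normrN ger0_norm ?fine_ge0 ?norm1_ge0// => /ltW gn.
  by exists n; rewrite -nfin lee_fin.
have [phi [mphi cphi gphi]] := (ag n).2 _ e20.
exists phi; split => //.
rewrite (splitr e) EFinD; apply: le_trans (leeD gn gphi).
apply: le_norm1D; [exact: measurable_funB..|].
move=> z; rewrite (distrC (g_ n z)) (le_trans _ (ler_normD _ _))//.
by rewrite addrA subrK.
Unshelve. all: by end_near. Qed.

End approximation.

Section borel_approximation.
Context (R : realType) (dT : measure_display) (T : measurableType dT).
Context (P : probability T R) (d : nat).
Notation S := (d.-tuple R * d.-tuple R)%type.
Variables X Y : T -> S.
Hypotheses (mX : measurable_fun setT X) (mY : measurable_fun setT Y).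

Import HBNNSimple.

Let apx := approximable P X Y.

Let apx_set : set (set S) := [set A | apx (\1_A : S -> R)].

(* Intersections are handled by [Num.min], which, unlike products, is
   1-Lipschitz for unbounded approximants. *)
Lemma sigma_algebra_approximable : sigma_algebra setT apx_set.
Proof.
have apxC A : apx_set A -> apx_set (~` A).
  move=> aA; rewrite /apx_set/= (_ : \1_(~` A) = fun z => 1 + (-1) * \1_A z).
    by apply: approximableD => //; [exact: approximable_cst|exact: approximableZ].
  by apply/funext => z; rewrite !indicE in_setC; case: (_ \in _); rewrite /=; ring.
have apxI A B : apx_set A -> apx_set B -> apx_set (A `&` B).
  move=> aA aB; rewrite /apx_set/= (_ : \1_(A `&` B) = fun z => Num.min (\1_A z) (\1_B z)).
    exact: approximable_min.
  apply/funext => z; rewrite !indicE in_setI.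
  by case: (_ \in _); case: (_ \in _); rewrite /= ?minxx ?(min_l ler01) ?(min_r ler01).
have apx0 : apx_set set0.
  by rewrite /apx_set/= indic0; exact: approximable_cst.
split => //; first by move=> A aA; rewrite setTD; exact: apxC.
move=> F aF.
(* A countable union is reached through its finite partial unions: at each point their indicators
   are eventually constant. *)
pose G n := \big[setU/set0]_(k < n) F k.
have aG n : apx_set (G n).
  rewrite /G; elim: n => [|n IH]; first by rewrite big_ord0.
  rewrite big_ord_recr/= -[X in apx_set X]setCK setCU.
  by apply: (apxC); apply: (apxI); exact: apxC.
rewrite /apx_set/=; apply: (@approximable_cvg _ _ _ _ _ _ _ mX mY (fun n => \1_(G n)) _ 1) => //.
- by move=> n z; rewrite indicE; case: (_ \in _); rewrite ?normr1 ?normr0.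
move=> z; have [[k _ Fkz]|nFz] := pselect ((\bigcup_k F k) z).
  apply: cvg_near_cst; exists k.+1 => // n /= kn.
  rewrite !indicE !mem_set//; first by exists k.
  by rewrite /G -bigcup_mkord; exists k.
apply: cvg_near_cst; apply: nearW => n.
rewrite !indicE !memNset// /G -bigcup_mkord => -[k _ Fkz].
by apply: nFz; exists k.
Qed.

(** The sets [C] with this property form a sigma-algebra, so open rays suffice. *)
Lemma approximable_coordinate (c : S -> R) (C : set R) :
  measurable_fun setT c -> seq_continuous c -> measurable C ->
  apx_set (c @^-1` C).
Proof.
move=> mc cc mC.
have sC : sigma_algebra setT (image_set_system setT c apx_set).
  exact/sigma_algebra_image/sigma_algebra_approximable.
suff : <<s @RGenOInfty.G R >> `<=` image_set_system setT c apx_set.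
  move=> /(_ C); rewrite /image_set_system/= setTI; apply.
  have : (@RGenOInfty.G R).-sigma.-measurable C by rewrite -RGenOInfty.measurableE.
  by [].
apply: smallest_sub => // _ [a ->]; rewrite /image_set_system/= setTI /apx_set/=.
(* Continuous ramps that vanish where [c z <= a] and eventually equal 1 where [c z > a]. *)
pose g n z : R := Num.min 1 (n%:R * Num.max 0 (c z - a)).
apply: (@approximable_cvg _ _ _ _ _ _ _ mX mY g _ 1) => [n|n z|z].
- apply: seq_continuous_approximable => //.
    apply: measurable_minr => //; apply: measurable_funM => //.
    by apply: measurable_maxr => //; exact: measurable_funB.
  apply: seq_continuous_min; first exact: seq_continuous_cst.
  apply: seq_continuousM; first exact: seq_continuous_cst.
  apply: seq_continuous_max; first exact: seq_continuous_cst.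
  by apply: seq_continuousD => //; exact: seq_continuous_cst.
- rewrite ger0_norm /g ?ge_min ?lexx//.
  by rewrite le_min ler01 mulr_ge0// le_max lexx.
have [az|za] := ltP a (c z).
  have caz : 0 < c z - a by rewrite subr_gt0.
  rewrite indicE mem_set ?/= ?in_itv/= ?az//.
  apply: cvg_near_cst; near=> n; rewrite /g (max_r (ltW caz)) min_l//.
  rewrite -ler_pdivrMr//; apply: ltW; near: n; exact: nbhs_infty_gtr.
rewrite indicE memNset ?/= ?in_itv/= ?andbT; last by apply/negP; rewrite -leNgt.
apply: cvg_near_cst; apply: nearW => n.
by rewrite /g max_l ?subr_le0// mulr0 min_r.
Unshelve. all: by end_near. Qed.

(** The same sigma-algebra argument applied twice: to the two projections generating the product,
    then to the coordinate cylinders generating each factor. *)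
Lemma measurable_approximable (A : set S) : measurable A -> apx_set A.
Proof.
have sS := sigma_algebra_approximable.
have tuple_coord (p : S -> d.-tuple R) (B : set (d.-tuple R)) :
  (forall i, measurable_fun setT (fun z => tnth (p z) i)) ->
  (forall i, seq_continuous (fun z => tnth (p z) i)) ->
  measurable B -> apx_set (p @^-1` B).
  move=> mp cp mB.
  suff : <<s @tuple_cylinders _ R d >> `<=` image_set_system setT p apx_set.
    move=> /(_ B); rewrite /image_set_system/= setTI; apply.
    exact: measurable_sub_tuple_cylinders.
  apply: smallest_sub; first exact: sigma_algebra_image.
  move=> _ [i [C mC ->]]; rewrite /image_set_system/= setTI.
  exact: (approximable_coordinate (mp i) (cp i) mC).
move: A; apply: smallest_sub => // B [] [C mC <-]; rewrite setTI.
- apply: tuple_coord => // i.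
    by apply: (measurableT_comp (measurable_tnth i)).
  by move=> z_ z h1 h2; exact: h1.
- apply: tuple_coord => // i.
    by apply: (measurableT_comp (measurable_tnth i)).
  by move=> z_ z h1 h2; exact: h2.
Qed.

(** Simple functions increasing to [f] are combinations of approximable indicators and inherit the
    bound [M], as [approximable_cvg] requires. *)
Lemma bounded_measurable_approximable (f : S -> R) (M : R) :
  measurable_fun setT f -> (forall z, 0 <= f z <= M) -> apx f.
Proof.
move=> mf f0M.
have mfE : measurable_fun setT (fun z => (f z)%:E) by exact/measurable_EFinP.
have f0 z : setT z -> (0 <= (f z)%:E)%E by rewrite lee_fin; case/andP: (f0M z).
pose f_ := nnsfun_approx measurableT mfE.
rewrite /apx; apply: (@approximable_cvg _ _ _ _ _ _ _ mX mY (fun n z => f_ n z) f M) => [n|n z|z].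
- rewrite (_ : (fun z => f_ n z) = fun z =>
      \sum_(r <- finmap.enum_fset (fset_set (range (f_ n)))) r * \1_(f_ n @^-1` [set r]) z).
    elim: (finmap.enum_fset _) => [|r s IH].
      by under eq_fun do rewrite big_nil; exact: approximable_cst.
    under eq_fun do rewrite big_cons.
    apply: approximableD => //; apply: approximableZ => //.
    exact: measurable_approximable.
  by apply/funext => z; rewrite fimfunE fsbig_finite.
- rewrite ger0_norm// /f_ nnsfun_approxE -lee_fin.
  apply: le_trans (le_approx n f0 _) _ => //.
  by rewrite lee_fin; case/andP: (f0M z).
have /fine_cvgP[_] := cvg_nnsfun_approx measurableT mfE f0 (I : setT z).
exact.
Qed.

End borel_approximation.

(** Turns closeness in L^1 into a one-sided comparison of the integrals of [p]-th powers. *)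
Lemma powR_dist_le (R : realType) (a b M p : R) : 1 < p ->
  0 <= a -> 0 <= b -> a <= M ->
  a `^ p <= b `^ p + p * M `^ (p - 1) * `|a - b|.
Proof.
move=> p1 a0 b0 aM.
have p0 : 0 < p by rewrite (lt_trans _ p1).
have q0 : 0 < p / (p - 1) by rewrite divr_gt0// subr_gt0.
have pq : (p / (p - 1))^-1 + p^-1 = 1 by field; rewrite gt_eqF// gt_eqF// subr_gt0.
(* Young's inequality for a^(p-1) * b gives the convexity bound
   a^p <= b^p + p a^(p-1) (a - b). *)
have := conjugate_powR (powR_ge0 a (p - 1)) b0 q0 p0 pq.
rewrite -powRrM (_ : (p - 1) * (p / (p - 1)) = p); last first.
  by field; rewrite gt_eqF// subr_gt0.
have aE : a `^ p = a * a `^ (p - 1) by rewrite mulr_powRB1.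
set A := a `^ p in aE *; set A1 := a `^ (p - 1) in aE *.
set Bp := b `^ p => /(ler_wpM2l (ltW p0)) yng.
have A1M : A1 <= M `^ (p - 1).
  apply: ge0_ler_powR; rewrite ?nnegrE ?subr_ge0 ?(ltW p1)//.
  exact: le_trans aM.
have A10 : 0 <= A1 by exact: powR_ge0.
have h1 : A <= Bp + p * A1 * (a - b).
  have E : p * (A / (p / (p - 1)) + Bp / p) = (p - 1) * A + Bp.
    by field; rewrite !gt_eqF// subr_gt0.
  have -> : p * A1 * (a - b) = p * A - p * (A1 * b) by rewrite aE; ring.
  by rewrite E in yng; lra.
apply: (le_trans h1); rewrite lerD2l -!mulrA ler_pM2l//.
apply: (@le_trans _ _ (A1 * `|a - b|)).
  by rewrite ler_wpM2l// ler_norm.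
by rewrite ler_wpM2r.
Qed.

Theorem theorem2p9 (R : realType) (d : nat) (sigma : R)
  (dT : measure_display) (T : measurableType dT) (P : probability T R)
  (B : 'I_d -> R -> T -> R)
  (f : d.-tuple R * d.-tuple R -> R) (t alpha : R)
  (x y : d.-tuple R * d.-tuple R) :
  (1 <= d)%N -> 0 < sigma ->
  is_brownian_motion P sigma B ->
  measurable_fun setT f -> (forall z, 0 <= f z) -> (exists M : R, forall z, f z <= M) ->
  0 < t -> 1 < alpha ->
  (fine (kolmogorov_semigroup P B t f x) `^ alpha <=
   C_alpha sigma alpha t x y *
   fine (kolmogorov_semigroup P B t (fun z => f z `^ alpha) y))%R.
Proof.
move=> _ sigma0 BB mf f0 [M fM] t0 a1.
have a0 : 0 < alpha by rewrite (lt_trans _ a1).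
pose X := kolmogorov_state t B x; pose Y := kolmogorov_state t B y.
have mX : measurable_fun setT X by exact: measurable_kolmogorov_state t0 BB x.
have mY : measurable_fun setT Y by exact: measurable_kolmogorov_state t0 BB y.
have f0M z : 0 <= f z <= M by rewrite f0 fM.
have M0 : 0 <= M by apply: le_trans (f0 x) (fM x).
pose u := Rintegral P setT (f \o X).
pose v := Rintegral P setT (fun w => f (Y w) `^ alpha).
rewrite -[fine _]/u -[fine (kolmogorov_semigroup _ _ _ _ y)]/v.
have [_ af] := bounded_measurable_approximable P mX mY mf f0M.
pose K := alpha * M `^ (alpha - 1).
have K0 : 0 <= K by rewrite mulr_ge0 ?powR_ge0// ltW.
have approx n : exists un : R, [/\ 0 <= un, `|u - un| <= n.+1%:R^-1 &
    un `^ alpha <= C_alpha sigma alpha t x y * (v + K * n.+1%:R^-1)].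
  have e0 : 0 < n.+1%:R^-1 :> R by rewrite invr_gt0 ltr0n.
  have [phi [mphi cphi fphi]] := af _ e0.
  (* Truncation keeps continuity and supplies the bounds needed by the continuous case; as [f] has
     values in [0, M], it does not increase the distance to [f]. *)
  pose psi z := Num.max 0 (Num.min (phi z) M).
  have mpsi : measurable_fun setT psi.
    by apply: measurable_maxr => //; exact: measurable_minr.
  have cpsi : seq_continuous psi.
    apply: seq_continuous_max; first exact: seq_continuous_cst.
    by apply: seq_continuous_min => //; exact: seq_continuous_cst.
  have psi0M z : 0 <= psi z <= M by rewrite /psi le_max lexx ge_max M0 ge_min lexx orbT.
  have fpsi z : `|f z - psi z| <= `|f z - phi z|.
    have := (ler_norm (f z - phi z), ler_norm (phi z - f z)).
    rewrite (distrC (phi z)) => -[h1 h2]; have /andP[fz0 fzM] := f0M z.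
    rewrite /psi ler_norml; apply/andP.
    by case: (ltP (phi z) M) => h3; [case: (ltP 0 (phi z))|case: (ltP 0 M)]; split; lra.
  have harnack := @seq_continuous_harnack _ _ _ P d sigma t B sigma0 t0 BB
    alpha M psi x y a1 mpsi psi0M cpsi.
  (* Each of the two states accounts for one summand of [norm1], so both integrated distances are at
     most the total error. *)
  have dist_le (Z : T -> _) : measurable_fun setT Z ->
      (forall w, `|f (Z w) - phi (Z w)| <=
                 `|f (X w) - phi (X w)| + `|f (Y w) - phi (Y w)|) ->
      P.-integrable setT (EFin \o (fun w => `|f (Z w) - psi (Z w)|)) /\
      Rintegral P setT (fun w => `|f (Z w) - psi (Z w)|) <= n.+1%:R^-1.
    move=> mZ hZ.
    have mfpsi : measurable_fun setT (fun w => `|f (Z w) - psi (Z w)|).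
      apply: measurableT_comp => //.
      by apply: measurable_funB; exact: measurableT_comp.
    have i1 : P.-integrable setT (EFin \o (fun w => `|f (Z w) - psi (Z w)|)).
      apply: (bounded_integrable P (M := M) mfpsi) => w; rewrite normr_ge0/=.
      have := (f0M (Z w), psi0M (Z w)) => -[/andP[? ?] /andP[? ?]].
      by rewrite ler_norml; apply/andP; split; lra.
    split=> //; rewrite -lee_fin fineK; last exact: integrable_fin_num.
    apply: le_trans fphi; apply: ge0_le_integral => //.
    - exact/measurable_EFinP.
    - apply/measurable_EFinP; apply: measurable_funD; apply: measurableT_comp => //;
      by apply: measurable_funB; exact: measurableT_comp.
    by move=> w _; rewrite lee_fin (le_trans (fpsi _)).
  have [iX dX] := dist_le X mX (fun w => ltac:(by rewrite lerDl)).
  have [iY dY] := dist_le Y mY (fun w => ltac:(by rewrite lerDr)).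
  exists (Rintegral P setT (psi \o X)); split.
  - by apply: Rintegral_ge0 => w _; case/andP: (psi0M (X w)).
  - have if1 : P.-integrable setT (EFin \o (f \o X)).
      exact: (bounded_integrable P (measurableT_comp mf mX) (fun w => f0M _)).
    have ipsi : P.-integrable setT (EFin \o (psi \o X)).
      exact: (bounded_integrable P (measurableT_comp mpsi mX) (fun w => psi0M _)).
    rewrite -RintegralB//; apply: le_trans dX.
    by apply: le_normr_Rintegral => //; exact: (integrableB measurableT if1 ipsi).
  apply: (le_trans harnack); rewrite ler_pM2l ?expR_gt0//.
  have pow0M (g : _ -> R) z : 0 <= g z <= M -> 0 <= g z `^ alpha <= M `^ alpha.
    move=> /andP[g0 gM]; rewrite powR_ge0/=.
    by apply: ge0_ler_powR; rewrite ?nnegrE// ltW.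
  have mpow (g : _ -> R) : measurable_fun setT g ->
      measurable_fun setT (fun w => g (Y w) `^ alpha).
    by move=> mg; apply: (measurableT_comp (measurable_powR alpha)); exact: measurableT_comp.
  have ifa : P.-integrable setT (EFin \o (fun w => f (Y w) `^ alpha)).
    by apply: (bounded_integrable P (mpow f mf)) => w; exact/pow0M/f0M.
  have ipsia : P.-integrable setT (EFin \o (fun w => psi (Y w) `^ alpha)).
    by apply: (bounded_integrable P (mpow psi mpsi)) => w; exact/pow0M/psi0M.
  have iKY : P.-integrable setT (EFin \o (fun w => K * `|f (Y w) - psi (Y w)|)).
    exact: (integrableZl measurableT K iY).
  (* On the right-hand side an upper bound for the powers of [psi] suffices; [powR_dist_le] gives it
     because [psi] is at most [M]. *)
  apply: (@le_trans _ _ (v + K * Rintegral P setT (fun w => `|f (Y w) - psi (Y w)|))).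
    rewrite -RintegralZl// -RintegralD//; apply: le_Rintegral => //.
      exact: (integrableD measurableT ifa iKY).
    move=> w _; rewrite distrC; have /andP[psi0 psiM] := psi0M (Y w).
    exact: powR_dist_le.
  by rewrite lerD2l ler_wpM2l.
have /choice[u_ hu] := approx.
have u_0 n : 0 <= u_ n by case: (hu n).
have cu : u_ @ \oo --> u.
  apply/cvgrPdist_lt => e e0; near=> n; have [_ un _] := hu n.
  apply: (le_lt_trans un); near: n; exact: (near_infty_natSinv_lt (PosNum e0)).
have cinv : n.+1%:R^-1 @[n --> \oo] --> (0 : R).
  apply/cvgrPdist_lt => e e0; near=> n; rewrite sub0r normrN ger0_norm ?invr_ge0//.
  by near: n; exact: (near_infty_natSinv_lt (PosNum e0)).
have cbound : C_alpha sigma alpha t x y * (v + K * n.+1%:R^-1) @[n --> \oo] -->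
    C_alpha sigma alpha t x y * v.
  apply: cvgMl_tmp; rewrite -[v in X in _ --> X]addr0 -[0 in X in _ --> X](mulr0 K).
  by apply: cvgD; [exact: cvg_cst|exact: cvgMl_tmp].
apply: (ler_cvg_to (cvg_powR a0 u_0 cu) cbound).
by apply: nearW => n; case: (hu n).
Unshelve. all: by end_near.
Qed.
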